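(* Let $\mathfrak g$ be a Lie algebra over a perfect field $\mathbb K$ of characteristic $2$, and let $D$ be a derivation of $\mathfrak g$ satisfying at least one of the following two conditions: 1. $D^2=\alpha D$ for some $\alpha\in\mathbb K$; 2. $D$ is nilpotent. Then the cocycle $c_D\in Z^2(\mathfrak g;\mathfrak g)$ defined by $c_D(x,y)=[Dx,Dy]$ for all $x,y\in\mathfrak g$ is either trivial or semitrivial.
   Context: Lie algebras in characteristic $2$ satisfy $[x,x]=0$ for all $x$. Cochains in $C^r(\mathfrak g;\mathfrak g)$ are alternating $r$-linear maps $\mathfrak g^r\to\mathfrak g$ with the Chevalley–Eilenberg differential $d$ for the adjoint module; $Z^2(\mathfrak g;\mathfrak g)$ and $B^2(\mathfrak g;\mathfrak g)$ are the $2$-cocycles and the $2$-coboundaries. For every derivation $D$, the map $c_D$ is a $2$-cocycle. A (global, one-parameter) deformation of $\mathfrak g$ is a Lie algebra structure on $\mathfrak g\otimes\mathbb K[[t]]$ of the form $[x,y]_t=[x,y]+t\,c_1(x,y)+t^2c_2(x,y)+\cdots$ for $x,y\in\mathfrak g$, extended linearly, where $c_j\in C^2(\mathfrak g;\mathfrak g)$. The resulting Lie algebra is called the deform. The linear part $c_1$ is then a cocycle, and the deformation is said to be generated by $c_1$. A cocycle $c\in Z^2(\mathfrak g;\mathfrak g)$ is trivial if $c\in B^2(\mathfrak g;\mathfrak g)$. It is semitrivial if $c\notin B^2(\mathfrak g;\mathfrak g)$ and there is a global deformation with linear part $c_1=c$ whose deform is isomorphic to the initial Lie algebra $\mathfrak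 g$. Here, in characteristic $2$, the isomorphism is allowed to be of the form $x\mapsto x+\sum_{i\ge1}f_i(x)(\sqrt t)^i$ with linear maps $f_i:\mathfrak g\to\mathfrak g$, i.e. the two Lie algebras are compared after extending scalars to $\mathbb K[[\sqrt t]]$. *)

(* Defs.v *)
From HB Require Import structures.
From mathcomp Require Import all_boot all_order all_algebra.
From mathcomp Require Import boolp.

Set Implicit Arguments.
Unset Strict Implicit.
Unset Printing Implicit Defensive.

Import GRing.Theory.
Local Open Scope ring_scope.

(** * Formal power series K[[t]] *)

(* A record rather than [nat -> K]: function types already carry the pointwise
   ring structure. *)
Record fps (K : fieldType) := Fps { fcoef : nat -> K }.

Section PowerSeries.
Variable K : fieldType.
Implicit Types a b c : fps K.

Lemma fpsP a b : (forall k, fcoef a k = fcoef b k) -> a = b.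
Proof. by case: a b => [a] [b] /= ab; congr Fps; apply: funext. Qed.

HB.instance Definition _ := gen_eqMixin (fps K).
HB.instance Definition _ := gen_choiceMixin (fps K).

Definition fps0 : fps K := Fps (fun=> 0).
Definition fps_opp a := Fps (fun k => - fcoef a k).
Definition fps_add a b := Fps (fun k => fcoef a k + fcoef b k).
Definition fps1 : fps K := Fps (fun k => (k == 0%N)%:R).
Definition fps_mul a b :=
  Fps (fun k => \sum_(i < k.+1) fcoef a i * fcoef b (k - i)%N).

Lemma fps_addA : associative fps_add.
Proof. by move=> a b c; apply: fpsP => k /=; rewrite addrA. Qed.
Lemma fps_addC : commutative fps_add.
Proof. by move=> a b; apply: fpsP => k /=; rewrite addrC. Qed.
Lemma fps_add0 : left_id fps0 fps_add.
Proof. by move=> a; apply: fpsP => k /=; rewrite add0r. Qed.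
Lemma fps_addN : left_inverse fps0 fps_opp fps_add.
Proof. by move=> a; apply: fpsP => k /=; rewrite addNr. Qed.

HB.instance Definition _ :=
  GRing.isZmodule.Build (fps K) fps_addA fps_addC fps_add0 fps_addN.

Let trunc n a : {poly K} := \poly_(i < n.+1) fcoef a i.

Let coef_trunc n a k : (k <= n)%N -> (trunc n a)`_k = fcoef a k.
Proof. by move=> kn; rewrite coef_poly ltnS kn. Qed.

Let coef_trunc_mul n a b k : (k <= n)%N ->
  fcoef (fps_mul a b) k = (trunc n a * trunc n b)`_k.
Proof.
move=> kn; rewrite coefM; apply: eq_bigr => i _.
rewrite !coef_trunc //; first exact: leq_trans (leq_subr _ _) kn.
by apply: leq_trans kn; rewrite -ltnS.
Qed.

Lemma fps_mulC : commutative fps_mul.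
Proof.
by move=> a b; apply: fpsP => k; rewrite !(coef_trunc_mul _ _ (leqnn k)) mulrC.
Qed.

Lemma fps_mulA : associative fps_mul.
Proof.
move=> a b c; apply: fpsP => n.
transitivity (trunc n a * (trunc n b * trunc n c))`_n; last first.
  rewrite mulrA coefM; apply: eq_bigr => i _.
  have le_in : (i <= n)%N by rewrite -ltnS.
  by rewrite (coef_trunc_mul _ _ le_in) coef_trunc ?leq_subr.
rewrite coefM; apply: eq_bigr => i _.
have le_in : (i <= n)%N by rewrite -ltnS.
by rewrite (coef_trunc_mul _ _ (leq_subr i n)) coef_trunc.
Qed.

Lemma fps_mul1 : left_id fps1 fps_mul.
Proof.
move=> a; apply: fpsP => k /=.
rewrite big_ord_recl /= mul1r subn0 big1 ?addr0 // => i _.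
by rewrite mul0r.
Qed.

Lemma fps_mulDl : left_distributive fps_mul fps_add.
Proof.
move=> a b c; apply: fpsP => k /=; rewrite -big_split.
by apply: eq_bigr => i _; rewrite mulrDl.
Qed.

Lemma fps1_neq0 : fps1 != 0.
Proof.
apply/negP => /eqP /(congr1 (fun a => fcoef a 0)) /= /eqP.
by rewrite oner_eq0.
Qed.

HB.instance Definition _ := GRing.Zmodule_isComNzRing.Build (fps K)
  fps_mulA fps_mulC fps_mul1 fps_mulDl fps1_neq0.

(* Substitution t := s^2, i.e. the embedding of K[[t]] into K[[s]], s = sqrt t. *)
Definition fps_sq a :=
  Fps (fun k => if odd k then 0 else fcoef a k./2).

End PowerSeries.

(** * The K[[t]]-module g ⊗ K[[t]] *)

(* For a vector space g, the canonical map from g ⊗ K[[t]] to sequences in g,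
   sending x ⊗ a to (a_k x)_k, is injective; its image consists of the sequences
   below.  For g of infinite dimension this is smaller than g[[t]]. *)
Definition is_tensor (K : fieldType) (g : lmodType K) (u : nat -> g) : Prop :=
  exists s : seq (fps K * g), forall k, u k = \sum_(p <- s) fcoef p.1 k *: p.2.

Record tens (K : fieldType) (g : lmodType K) :=
  Tens { tcoef : nat -> g; tensP : is_tensor tcoef }.

Section Tensor.
Variables (K : fieldType) (g : lmodType K).
Implicit Types (u v : tens g) (a b : fps K).

Lemma tens_eq u v : (forall k, tcoef u k = tcoef v k) -> u = v.
Proof.
case: u v => [u pu] [v pv] /= /funext uv; case: _ / uv pv => pv.
by congr Tens; apply: Prop_irrelevance.
Qed.

HB.instance Definition _ := gen_eqMixin (tens g).
HB.instance Definition _ := gen_choiceMixin (tens g).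

Lemma tens0_subproof : is_tensor (fun=> 0 : g).
Proof. by exists [::] => k; rewrite big_nil. Qed.

Lemma tens_opp_subproof u : is_tensor (fun k => - tcoef u k).
Proof.
have [s us] := tensP u; exists [seq (- p.1, p.2) | p <- s] => k.
rewrite us big_map -sumrN; apply: eq_bigr => p _.
by rewrite /= scaleNr.
Qed.

Lemma tens_add_subproof u v : is_tensor (fun k => tcoef u k + tcoef v k).
Proof.
have [s us] := tensP u; have [r vr] := tensP v.
by exists (s ++ r) => k; rewrite big_cat us vr.
Qed.

Lemma tens_actE a (u : nat -> g) (s : seq (fps K * g)) :
    (forall k, u k = \sum_(p <- s) fcoef p.1 k *: p.2) ->
  forall k, \sum_(i < k.+1) fcoef a i *: u (k - i)%N
    = \sum_(p <- s) fcoef (a * p.1) k *: p.2.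
Proof.
move=> us k.
under eq_bigr => i _ do rewrite us scaler_sumr.
rewrite exchange_big; apply: eq_bigr => p _.
by rewrite /= scaler_suml; apply: eq_bigr => i _; rewrite scalerA.
Qed.

Lemma tens_scale_subproof a u :
  is_tensor (fun k => \sum_(i < k.+1) fcoef a i *: tcoef u (k - i)%N).
Proof.
have [s us] := tensP u; exists [seq (a * p.1, p.2) | p <- s] => k.
by rewrite big_map (tens_actE a us).
Qed.

Lemma tens_pure_subproof a (x : g) : is_tensor (fun k => fcoef a k *: x).
Proof. by exists [:: (a, x)] => k; rewrite big_seq1. Qed.

Lemma tens_sq_subproof u :
  is_tensor (fun k => if odd k then 0 else tcoef u k./2).
Proof.
have [s us] := tensP u; exists [seq (fps_sq p.1, p.2) | p <- s] => k.
rewrite big_map us /=; case: (odd k) => //.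
by rewrite big1 // => p _; rewrite scale0r.
Qed.

Definition tens0 := Tens tens0_subproof.
Definition tens_opp u := Tens (tens_opp_subproof u).
Definition tens_add u v := Tens (tens_add_subproof u v).
Definition tens_scale a u := Tens (tens_scale_subproof a u).

Lemma tens_addA : associative tens_add.
Proof. by move=> a b c; apply: tens_eq => k /=; rewrite addrA. Qed.
Lemma tens_addC : commutative tens_add.
Proof. by move=> a b; apply: tens_eq => k /=; rewrite addrC. Qed.
Lemma tens_add0 : left_id tens0 tens_add.
Proof. by move=> a; apply: tens_eq => k /=; rewrite add0r. Qed.
Lemma tens_addN : left_inverse tens0 tens_opp tens_add.
Proof. by move=> a; apply: tens_eq => k /=; rewrite addNr. Qed.

HB.instance Definition _ :=
  GRing.isZmodule.Build (tens g) tens_addA tens_addC tens_add0 tens_addN.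

Lemma tens_scaleA a b u : tens_scale a (tens_scale b u) = tens_scale (a * b) u.
Proof.
have [s us] := tensP u; apply: tens_eq => k /=.
have bus k' : \sum_(i < k'.+1) fcoef b i *: tcoef u (k' - i)%N
    = \sum_(p <- [seq (b * p.1, p.2) | p <- s]) fcoef p.1 k' *: p.2.
  by rewrite big_map (tens_actE b us).
rewrite (tens_actE a bus) (tens_actE (a * b) us) big_map.
by apply: eq_bigr => p _; rewrite mulrA.
Qed.

Lemma tens_scale1 : left_id 1 tens_scale.
Proof.
move=> u; have [s us] := tensP u; apply: tens_eq => k /=.
by rewrite (tens_actE 1 us) us; apply: eq_bigr => p _; rewrite mul1r.
Qed.

Lemma tens_scaleDr : right_distributive tens_scale +%R.
Proof.
move=> a u v; apply: tens_eq => k /=; rewrite -big_split.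
by apply: eq_bigr => i _; rewrite scalerDr.
Qed.

Lemma tens_scaleDl u : {morph tens_scale^~ u : a b / a + b}.
Proof.
move=> a b; apply: tens_eq => k /=; rewrite -big_split.
by apply: eq_bigr => i _; rewrite scalerDl.
Qed.

HB.instance Definition _ := GRing.Zmodule_isLmodule.Build (fps K) (tens g)
  tens_scaleA tens_scale1 tens_scaleDr tens_scaleDl.

Definition pure (x : g) a : tens g := Tens (tens_pure_subproof a x).

(* The map g ⊗ K[[t]] -> g ⊗ K[[s]] given by t := s^2. *)
Definition tens_sq u : tens g := Tens (tens_sq_subproof u).

End Tensor.

(** * Lie algebras, derivations, cochains with adjoint coefficients *)

(* Frobenius is onto in characteristic p; no condition in characteristic 0. *)
Definition perfect_field (K : fieldType) : Prop :=
  forall p : nat, p \in [pchar K] -> forall x : K, exists y : K, y ^+ p = x.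

Section Lie.
Variables (R : comNzRingType) (L : lmodType R).
Implicit Types (br c : L -> L -> L) (D : L -> L).

(* The module C^2(L; L). *)
Definition cochain2 c : Prop :=
  bilinear_for *:%R *:%R c /\ forall x, c x x = 0.

Definition lie_bracket br : Prop :=
  cochain2 br /\
  forall x y z, br x (br y z) + br y (br z x) + br z (br x y) = 0.

Definition derivation br D : Prop :=
  linear D /\ forall x y, D (br x y) = br (D x) y + br x (D y).

(* Chevalley–Eilenberg differentials C^1 -> C^2 and C^2 -> C^3. *)
Definition CE1 br (f : L -> L) x y := br x (f y) - br y (f x) - f (br x y).

Definition CE2 br c x y z :=
  br x (c y z) - br y (c x z) + br z (c x y)
  - c (br x y) z + c (br x z) y - c (br y z) x.

Definition cocycle2 br c : Prop :=
  cochain2 c /\ forall x y z, CE2 br c x y z = 0.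

Definition coboundary2 br c : Prop :=
  exists f : {linear L -> L}, forall x y, c x y = CE1 br f x y.

Definition trivial_cocycle br c : Prop := cocycle2 br c /\ coboundary2 br c.

End Lie.

(** * Deformations *)

Section Deformation.
Variables (K : fieldType) (g : lmodType K).
Implicit Types (br c : g -> g -> g) (bt : tens g -> tens g -> tens g).

(* [bt] is the bracket [x,y]_t = [x,y] + t c_1(x,y) + t^2 c_2(x,y) + ... *)
Definition deformation br (cs : nat -> g -> g -> g) bt : Prop :=
  [/\ lie_bracket bt,
      forall j, cochain2 (cs j),
      forall x y, cs 0%N x y = br x y
    & forall x y k, tcoef (bt (pure x 1) (pure y 1)) k = cs k x y].

(* [b0] is the K[[s]]-bilinear extension of [br] to g ⊗ K[[s]]. *)
Definition constant_extension br (b0 : tens g -> tens g -> tens g) : Prop :=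
  bilinear_for *:%R *:%R b0 /\
  forall x y, b0 (pure x 1) (pure y 1) = pure (br x y) 1.

(* [bs] is the bracket on g ⊗ K[[s]] = K[[s]] ⊗_{K[[t]]} (g ⊗ K[[t]]) obtained
   from [bt] by extension of scalars along t := s^2. *)
Definition sqrt_extension bt (bs : tens g -> tens g -> tens g) : Prop :=
  bilinear_for *:%R *:%R bs /\
  forall u v, bs (tens_sq u) (tens_sq v) = tens_sq (bt u v).

(* After extension of scalars to K[[s]], s = sqrt t, the deform is isomorphic to
   the initial algebra via some x |-> x + \sum_(i >= 1) f_i(x) s^i. *)
Definition sqrt_isomorphic br bt : Prop :=
  exists b0 bs : tens g -> tens g -> tens g,
  exists (f : nat -> {linear g -> g}) (phi : {linear tens g -> tens g}),
    [/\ constant_extension br b0, sqrt_extension bt bs,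
        bijective phi,
        (forall x, f 0%N x = x) /\
        (forall x k, tcoef (phi (pure x 1)) k = f k x)
      & forall u v, phi (bs u v) = b0 (phi u) (phi v)].

Definition semitrivial_cocycle br c : Prop :=
  [/\ cocycle2 br c, ~ coboundary2 br c
    & exists (cs : nat -> g -> g -> g) (bt : tens g -> tens g -> tens g),
        [/\ deformation br cs bt, forall x y, cs 1%N x y = c x y
          & sqrt_isomorphic br bt]].

End Deformation.

(* Main.v *)
Require Import Defs.
From HB Require Import structures.
From mathcomp Require Import all_boot all_order all_algebra.
From mathcomp Require Import boolp.
Import GRing.Theory.
Local Open Scope ring_scope.

(** Extend scalars to K[[s]], s^2 = t.  A bracket of the form
    phi^-1 [phi x, phi y], with phi = 1 + O(s), is isomorphic to the initial one
    by construction; it is the extension of a deformation in t exactly when only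
    even powers of s occur in it.  In characteristic 2 this says that its
    derivative in s vanishes, and that derivative measures the failure of
    phi' phi^-1 to be a derivation.  Look for phi = E(s D) with E in F_2[[x]]:
    since the powers D^(2^i) are derivations, it suffices that E'/E be a
    combination of the x^(2^i - 1).  The series

      E = 1 + F,   F = \sum_(i >= 0) x^(2^i),

    has E' = 1, and F^2 = F + x gives E^-1 = F / x = \sum_(i >= 0) x^(2^i - 1);
    so it qualifies.

    What the proof uses is the resulting closed form of the bracket.  Let
    U = \sum_(i >= 0) t^(2^i) D^(2^(i+1)) be the even part of F(s D), which is
    again a derivation, and let P = (1 + U)^-1.  Then phi = 1 + U + s D, and

      [x,y]_t = [x,y] + P ([U x, U y] + t [D x, D y])

    satisfies phi [x,y]_t = [phi x, phi y] ([twist_conjugate]); the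
    computation rests on U^2 = U + t D^2.  The coefficient of t is [D x, D y],
    as U = O(t).  The formula makes sense over K[[t]], and the Jacobi identity
    for [.,.]_t is that of [.,.] transported by phi.  So c_D is always the
    linear part of a deformation whose deform is isomorphic to the initial
    algebra, and it is trivial or semitrivial according to whether it is a
    coboundary.

    Both hypotheses on D enter through one consequence: the powers of D applied
    to a given vector span a finite-dimensional space, so that a power series in
    s D maps g to g \otimes K[[s]] and not merely to g[[s]]
    ([quadratic_orbit_fin], [nilpotent_orbit_fin]).

    Most identities are between maps that are K[[s]]-linear in each argument, so
    they are checked on the elements x \otimes 1 only, by [tens_ind]. *)

Set Implicit Arguments.
Unset Strict Implicit.
Unset Printing Implicit Defensive.

(** * Sums over antidiagonals *)

Lemma sum_even_index (V : nmodType) (h : nat -> V) k :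
  \sum_(i < k.+1) (if odd i then 0 else h i./2) = \sum_(j < k./2.+1) h j.
Proof.
elim: k => [|k IH]; first by rewrite !big_ord1.
rewrite big_ord_recr IH /= uphalf_half; case: (odd k) => /=.
  by rewrite [RHS]big_ord_recr.
by rewrite addr0.
Qed.

Lemma sum_even_antidiag (V : nmodType) (h : nat -> nat -> V) k :
  \sum_(i < k.+1) (if odd i || odd (k - i) then 0 else h i./2 (k - i)./2)
  = if odd k then 0 else \sum_(j < k./2.+1) h j (k./2 - j)%N.
Proof.
case: ifP => ko.
  rewrite big1 // => -[i /= ik] _; rewrite oddB // ko.
  by case: (odd i).
rewrite -(sum_even_index (fun j => h j (k./2 - j)%N)).
apply: eq_bigr => -[i /= ik] _.
rewrite oddB // ko addFb orbb; case: ifPn => // io.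
rewrite -[in (k - i)%N](@even_halfK k) ?ko // -[in (_ - i)%N](even_halfK io).
by rewrite -doubleB doubleK.
Qed.

(** The reflection [i |-> k - i] pairs the terms off, and the two members of a
    pair cancel; only a fixed point survives. *)
Lemma sum_sym_char2 (V : nmodType) (h : nat -> V) k :
    (forall x : V, x + x = 0) ->
    (forall i, (i <= k)%N -> h (k - i)%N = h i) ->
  \sum_(i < k.+1) h i = if odd k then 0 else h k./2.
Proof.
move=> VV; elim/ltn_ind: k h => -[|[|k]] IH h sym.
- by rewrite big_ord1.
- by rewrite big_ord_recl big_ord1 -[h (lift _ _)]sym // VV.
rewrite big_ord_recl big_ord_recr /= addrCA -[h 0%N]sym // VV addr0.
rewrite (IH k _ (fun i => h i.+1)) /= ?negbK // => i ik.
by rewrite -subSn // -[RHS]sym ?subSS // ltnW.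
Qed.

(** * Power series in characteristic 2 *)

Section SeriesChar2.
Variable K : fieldType.
Implicit Types a b : fps K.

Definition fpsC (c : K) : fps K := Fps (fun k => if k == 0%N then c else 0).
Definition fpsX : fps K := Fps (fun k => (k == 1%N)%:R).

Lemma fcoefD a b k : fcoef (a + b) k = fcoef a k + fcoef b k.
Proof. by []. Qed.

Lemma fcoef1 k : fcoef (1 : fps K) k = (k == 0%N)%:R.
Proof. by []. Qed.

Lemma fcoefM a b k :
  fcoef (a * b) k = \sum_(i < k.+1) fcoef a i * fcoef b (k - i)%N.
Proof. by []. Qed.

Lemma fcoefXM a k : fcoef (fpsX * a) k = if k is j.+1 then fcoef a j else 0.
Proof.
rewrite fcoefM big_ord_recl /= mul0r add0r; case: k => [|k].
  by rewrite big_ord0.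
by rewrite big_ord_recl /= subn1 mul1r big1 ?addr0 // => i _; rewrite mul0r.
Qed.

Lemma fpsX_inj : injective (fun a => fpsX * a).
Proof.
move=> a b ab; apply: fpsP => k.
by have := congr1 (fun c => fcoef c k.+1) ab; rewrite !fcoefXM.
Qed.

(** [F = \sum_i x^(2^i)], as [2.-nat k] says that [k] is a power of 2. *)
Definition additive_series : fps K := Fps (fun k => (2%N.-nat k)%:R).

(** [\sum_i x^(2^i - 1) = F / x], the inverse of [1 + F]. *)
Definition additive_inverse : fps K := Fps (fun k => (2%N.-nat k.+1)%:R).

Hypothesis char2 : 2%N \in [pchar K].

Lemma fps_addcc a : a + a = 0.
Proof. by apply: fpsP => k; rewrite fcoefD addrr_pchar2. Qed.

(** Squaring is additive and acts on constants as Frobenius, which fixes the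
    coefficients 0 and 1. *)
Lemma fps_sqr a :
    (forall k, fcoef a k * fcoef a k = fcoef a k) -> a * a = fps_sq a.
Proof.
move=> aa; apply: fpsP => k; rewrite fcoefM.
rewrite (@sum_sym_char2 _ (fun i => fcoef a i * fcoef a (k - i)%N)) /=.
- case: ifPn => // ko.
  by rewrite -{2}(even_halfK ko) -addnn addnK aa.
- by move=> x; rewrite addrr_pchar2.
- by move=> i ik; rewrite subKn // mulrC.
Qed.

Lemma natr_bool_idem (b : bool) : b%:R * b%:R = b%:R :> K.
Proof. by case: b; rewrite ?mul1r ?mul0r. Qed.

Let F := additive_series.
Let G := additive_inverse.

Lemma additive_series_sqr : F * F = fps_sq F.
Proof. by apply: fps_sqr => k; apply: natr_bool_idem. Qed.

Lemma additive_inverse_sqr : G * G = fps_sq G.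
Proof. by apply: fps_sqr => k; apply: natr_bool_idem. Qed.

Lemma pow2_odd k : odd k -> 2%N.-nat k = (k == 1%N).
Proof.
move=> ko; apply/idP/eqP => [/p_natP[[|m] km]|->//]; first by rewrite km.
by move: ko; rewrite km expnS oddM.
Qed.

Lemma pow2_even k : ~~ odd k -> 2%N.-nat k = 2%N.-nat k./2.
Proof. by move=> ke; rewrite -{1}(even_halfK ke) -muln2 pnatM andbT. Qed.

Lemma additive_seriesE : F = fpsX + F * F.
Proof.
rewrite additive_series_sqr; apply: fpsP => k; rewrite fcoefD /=.
case: ifPn => [ko|ke]; first by rewrite pow2_odd // addr0.
by rewrite pow2_even //; case: k ke => [|[|k]]; rewrite ?add0r.
Qed.

(** [x (1 + F) G = (1 + F) F = F + F^2 = x], where [G = F / x]. *)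
Lemma additive_inverseP : (1 + F) * G = 1.
Proof.
have XG : fpsX * G = F by apply: fpsP => -[|k]; rewrite fcoefXM.
apply: fpsX_inj => /=; rewrite mulrCA XG mulrDl mul1r {1}additive_seriesE.
by rewrite -addrA fps_addcc addr0 mulr1.
Qed.

End SeriesChar2.

(** * Twisting a Lie bracket by derivations *)

Section Bilinear.
Variables (R : comNzRingType) (L : lmodType R) (b : L -> L -> L).
Hypothesis b_bil : bilinear_for *:%R *:%R b.

Lemma bilDl x y z : b (x + y) z = b x z + b y z.
Proof. by have := b_bil.1 z 1 x y; rewrite /= !scale1r. Qed.
Lemma bilDr z x y : b z (x + y) = b z x + b z y.
Proof. by have := b_bil.2 z 1 x y; rewrite /= !scale1r. Qed.
Lemma bil0l z : b 0 z = 0.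
Proof. by apply: (addrI (b 0 z)); rewrite -bilDl !addr0. Qed.
Lemma bil0r z : b z 0 = 0.
Proof. by apply: (addrI (b z 0)); rewrite -bilDr !addr0. Qed.
Lemma bilZl c x z : b (c *: x) z = c *: b x z.
Proof. by have := b_bil.1 z c x 0; rewrite /= bil0l !addr0. Qed.
Lemma bilZr c z x : b z (c *: x) = c *: b z x.
Proof. by have := b_bil.2 z c x 0; rewrite /= bil0r !addr0. Qed.
End Bilinear.

Section Alternating.
Variables (R : comNzRingType) (L : lmodType R) (b : L -> L -> L).
Hypotheses (L2 : forall x : L, x + x = 0) (b_alt : cochain2 b).

Lemma char2_add_eq0 (x y : L) : x + y = 0 -> x = y.
Proof. by move/(congr1 (+%R^~ y)); rewrite -addrA L2 addr0 add0r. Qed.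

Lemma alt_sym x y : b x y = b y x.
Proof.
have [b_bil bxx] := b_alt; apply: char2_add_eq0.
by have := bxx (x + y); rewrite (bilDl b_bil) !(bilDr b_bil) !bxx add0r addr0.
Qed.
End Alternating.

Section Twist.
Variables (R : comNzRingType) (L : lmodType R) (br : L -> L -> L).
Hypotheses (L2 : forall x : L, x + x = 0) (br_bil : bilinear_for *:%R *:%R br).
Variables (D U P : {linear L -> L}) (s : R).

(** [D] and [U] stand for the derivation and for the even part of [F(s D)], and
    [P] for the inverse of [1 + U]; [r] is [t] over K[[t]] and [s^2] over
    K[[s]]. *)
Definition twist r x y :=
  br x y + P (br (U x) (U y) + r *: br (D x) (D y)).

Lemma twist_bilinear r : bilinear_for *:%R *:%R (twist r).
Proof.
split=> [z a x y|z a x y]; rewrite /twist /= !linearP /=;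
  rewrite !(bilDl br_bil, bilDr br_bil, bilZl br_bil, bilZr br_bil);
  by rewrite !linearD !linearZ /= !addrA [LHS](ACl (1*3*5*2*4*6)).
Qed.

Lemma twist_alt r : (forall x, br x x = 0) -> forall x, twist r x x = 0.
Proof. by move=> bxx x; rewrite /twist !bxx scaler0 !addr0 linear0. Qed.

Hypotheses (derD : derivation br D) (derU : derivation br U).
Hypothesis (DU : forall x, D (U x) = U (D x)).
Hypothesis UU : forall x, U (U x) = U x + (s * s) *: D (D x).
Hypothesis PK : forall x, P (x + U x) = x.
Hypothesis KP : forall x, P x + U (P x) = x.

Let W x y := br (U x) (D y) + br (D x) (U y).

(** This is the vanishing of the odd part of [phi^-1 [phi x, phi y]].  The map
    [1 + U] is injective; it turns the left side into [D V], [V] being the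
    argument of [P], and expanding [U (W x y)] with [UU] gives [W x y + D V]. *)
Lemma twist_odd_part x y :
  D (P (br (U x) (U y) + (s * s) *: br (D x) (D y))) = W x y.
Proof.
set V := _ + _; rewrite -[LHS]PK -[RHS]PK; congr (P _).
rewrite -DU -linearD KP.
have UW : U (W x y) = W x y + D V.
  rewrite /W /V !linearD linearZ /= !(derD.2, derU.2) !UU !DU.
  rewrite !(bilDl br_bil, bilDr br_bil, bilZl br_bil, bilZr br_bil) scalerDr.
  by rewrite !addrA [LHS](ACl (1*5*4*3*2*6)).
by rewrite UW addrA L2 add0r.
Qed.

Lemma twist_conjugate x y :
  let phi w := w + U w + s *: D w in
  phi (twist (s * s) x y) = br (phi x) (phi y).
Proof.
move=> phi; set Z := P (br (U x) (U y) + (s * s) *: br (D x) (D y)).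
have phiD u v : phi (u + v) = phi u + phi v.
  by rewrite /phi !linearD !addrA [LHS](ACl (1*3*5*2*4*6)).
rewrite [twist _ _ _]/twist phiD -/Z.
rewrite {2}/phi KP twist_odd_part /phi /W !(derD.2, derU.2).
rewrite !(bilDl br_bil, bilDr br_bil, bilZl br_bil, bilZr br_bil).
rewrite !scalerDr !scalerA.
by rewrite !addrA [LHS](ACl (1*3*5*2*6*8*4*9*7)).
Qed.
End Twist.

Section LinearPack.
Variables (R : comNzRingType) (L : lmodType R) (f : L -> L).
Hypothesis f_lin : linear f.

Definition lin_pack : {linear L -> L} :=
  HB.pack f (GRing.isLinear.Build R L L _ f f_lin).
End LinearPack.

(** * Extension of scalars *)

Section TensorCoef.
Variables (K : fieldType) (g : lmodType K).
Implicit Types (u v : tens g) (a : fps K) (x y : g).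

Lemma tcoefD u v k : tcoef (u + v) k = tcoef u k + tcoef v k.
Proof. by []. Qed.

Lemma tcoefZ a u k :
  tcoef (a *: u) k = \sum_(i < k.+1) fcoef a i *: tcoef u (k - i)%N.
Proof. by []. Qed.

Lemma tcoef_sum (I : Type) (r : seq I) (F : I -> tens g) k :
  tcoef (\sum_(i <- r) F i) k = \sum_(i <- r) tcoef (F i) k.
Proof. exact: (big_morph (fun u => tcoef u k)). Qed.

Lemma tcoef_pure x k : tcoef (pure x 1) k = if k == 0%N then x else 0.
Proof. by rewrite /=; case: eqP; rewrite ?scale1r ?scale0r. Qed.

Lemma scale_pure a x : a *: pure x 1 = pure x a.
Proof.
apply: tens_eq => k; rewrite tcoefZ big_ord_recr /= subnn scale1r.
rewrite big1 ?add0r // => -[i /= ik] _.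
by rewrite subn_eq0 leqNgt ik scale0r scaler0.
Qed.

(** g \otimes K[[t]] is generated by the [x \otimes 1], so that K[[t]]-linear
    identities need only be checked there. *)
Lemma tens_ind (P : tens g -> Prop) :
    P 0 -> (forall a x u, P u -> P (a *: pure x 1 + u)) -> forall u, P u.
Proof.
move=> P0 PS u; have [s us] := tensP u.
have -> : u = \sum_(p <- s) p.1 *: pure p.2 1.
  apply: tens_eq => k; rewrite us tcoef_sum.
  by apply: eq_bigr => p _; rewrite scale_pure.
elim: s {us} => [|p s IH]; first by rewrite big_nil.
by rewrite big_cons; apply: PS.
Qed.

Lemma tcoefXZ u k : tcoef (fpsX K *: u) k = if k is j.+1 then tcoef u j else 0.
Proof.
rewrite tcoefZ big_ord_recl /= scale0r add0r; case: k => [|k].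
  by rewrite big_ord0.
rewrite big_ord_recl /= subn1 scale1r big1 ?addr0 // => i _.
by rewrite scale0r.
Qed.

Lemma tcoefCZ c u k : tcoef (fpsC c *: u) k = c *: tcoef u k.
Proof.
rewrite tcoefZ big_ord_recl /= subn0 big1 ?addr0 // => i _.
by rewrite scale0r.
Qed.

Lemma pure_linear c x y : pure (c *: x + y) 1 = fpsC c *: pure x 1 + pure y 1.
Proof.
apply: tens_eq => k; rewrite tcoefD tcoefCZ !tcoef_pure.
by case: eqP; rewrite ?scaler0 ?addr0.
Qed.

End TensorCoef.

Section Extension.
Variables (K : fieldType) (g : lmodType K).

Lemma is_tensor_eq (w : tens g) (f : nat -> g) :
  (forall k, f k = tcoef w k) -> is_tensor f.
Proof. by have [s ws] := tensP w => fw; exists s => k; rewrite fw. Qed.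

Variable h : nat -> {linear g -> g}.
Hypothesis h_fin : forall x, is_tensor (fun k => h k x).

Let ext_coef (u : tens g) k := \sum_(i < k.+1) h (k - i)%N (tcoef u i).

Let ext_coefE (u : tens g) (s : seq (fps K * g)) :
    (forall k, tcoef u k = \sum_(p <- s) fcoef p.1 k *: p.2) ->
  forall k, ext_coef u k = tcoef (\sum_(p <- s) p.1 *: Tens (h_fin p.2)) k.
Proof.
move=> us k; rewrite tcoef_sum /ext_coef.
under eq_bigr => i _ do rewrite us linear_sum.
rewrite exchange_big; apply: eq_bigr => p _; rewrite tcoefZ.
by apply: eq_bigr => i _; rewrite linearZ.
Qed.

Lemma ext_subproof (u : tens g) : is_tensor (ext_coef u).
Proof. by have [s us] := tensP u; apply: is_tensor_eq (ext_coefE us). Qed.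

(** The [h k] are the coefficients of a K-linear map [g -> g \otimes K[[t]]], and
    [ext] is its unique K[[t]]-linear extension to [g \otimes K[[t]]]. *)
Definition ext u : tens g := Tens (ext_subproof u).

Lemma tcoef_ext u k :
  tcoef (ext u) k = \sum_(i < k.+1) h (k - i)%N (tcoef u i).
Proof. by []. Qed.

Lemma ext_linear : linear ext.
Proof.
move=> a u v; have [s us] := tensP u; have [r vr] := tensP v.
apply: tens_eq => k; rewrite tcoefD.
have auv j : tcoef (a *: u + v) j
    = \sum_(p <- [seq (a * p.1, p.2) | p <- s] ++ r) fcoef p.1 j *: p.2.
  by rewrite tcoefD tcoefZ (tens_actE a us) vr big_cat big_map.
have -> : ext u = \sum_(p <- s) p.1 *: Tens (h_fin p.2).
  by apply: tens_eq; apply: ext_coefE.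
rewrite [LHS](ext_coefE auv) big_cat big_map /= -(ext_coefE vr) -tcoefZ.
rewrite scaler_sumr; congr (tcoef _ k + _).
by apply: eq_bigr => p _; rewrite scalerA.
Qed.

HB.instance Definition _ :=
  GRing.isLinear.Build (fps K) (tens g) (tens g) _ ext ext_linear.

Lemma ext_pure x : ext (pure x 1) = Tens (h_fin x).
Proof.
apply: tens_eq => k; rewrite tcoef_ext big_ord_recl tcoef_pure subn0.
by rewrite big1 ?addr0 // => i _; rewrite tcoef_pure linear0.
Qed.

End Extension.

Section Constant.
Variables (K : fieldType) (g : lmodType K) (f : {linear g -> g}).

Lemma const_fin x : is_tensor (fun k => (fcoef (1 : fps K) k \*: f) x).
Proof. exact: (tens_pure_subproof 1 (f x)). Qed.

Definition cext : {linear tens g -> tens g} := ext const_fin.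

Lemma tcoef_cext u k : tcoef (cext u) k = f (tcoef u k).
Proof.
rewrite tcoef_ext big_ord_recr /= subnn scale1r.
rewrite big1 ?add0r // => -[i /= ik] _.
by rewrite subn_eq0 leqNgt ik scale0r.
Qed.

End Constant.

(** * The bracket extended to power series *)

Section Bracket.
Variables (K : fieldType) (g : lmodType K) (br : g -> g -> g).
Hypothesis br_bil : bilinear_for *:%R *:%R br.

Let brr x := lin_pack (br_bil.2 x).
Let brl y := lin_pack (br_bil.1 y).

Lemma ext_bracket_subproof (u v : tens g) :
  is_tensor (fun k => \sum_(i < k.+1) br (tcoef u i) (tcoef v (k - i)%N)).
Proof.
have v_fin x : is_tensor (fun k => brl (tcoef v k) x).
  have [s vs] := tensP v; exists [seq (p.1, br x p.2) | p <- s] => k.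
  rewrite big_map [LHS](_ : _ = brr x (tcoef v k)) // vs linear_sum.
  by apply: eq_bigr => p _; rewrite linearZ.
exact: tensP (ext v_fin u).
Qed.

Definition ext_bracket u v := Tens (ext_bracket_subproof u v).

Lemma tcoef_ext_bracket u v k : tcoef (ext_bracket u v) k
  = \sum_(i < k.+1) br (tcoef u i) (tcoef v (k - i)%N).
Proof. by []. Qed.

Lemma ext_bracket_pure_l x v k :
  tcoef (ext_bracket (pure x 1) v) k = br x (tcoef v k).
Proof.
rewrite tcoef_ext_bracket big_ord_recl tcoef_pure subn0 big1 ?addr0 // => i _.
by rewrite tcoef_pure (bil0l br_bil).
Qed.

Lemma ext_bracket_pure_r u y k :
  tcoef (ext_bracket u (pure y 1)) k = br (tcoef u k) y.
Proof.
rewrite tcoef_ext_bracket big_ord_recr /= subnn scale1r big1 ?add0r //.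
by move=> [i /= ik] _; rewrite subn_eq0 leqNgt ik scale0r (bil0r br_bil).
Qed.

Lemma ext_bracket_pure x y :
  ext_bracket (pure x 1) (pure y 1) = pure (br x y) 1.
Proof.
apply: tens_eq => k; rewrite ext_bracket_pure_l !tcoef_pure.
by case: eqP => // _; rewrite (bil0r br_bil).
Qed.

(** For fixed [v], the bracket with [v] is itself an extension of scalars. *)
Lemma ext_bracket_linear_l v : linear (ext_bracket ^~ v).
Proof.
move=> a u w; have v_fin x : is_tensor (fun k => brl (tcoef v k) x).
  apply: (@is_tensor_eq _ _ (ext_bracket (pure x 1) v)) => k.
  by rewrite ext_bracket_pure_l.
have extv z : ext_bracket z v = ext v_fin z by apply: tens_eq.
by rewrite !extv linearP.
Qed.

Lemma ext_bracket_bilinear : bilinear_for *:%R *:%R ext_bracket.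
Proof.
split=> [v|u a v w]; first exact: ext_bracket_linear_l.
have P0 z : ext_bracket 0 z = 0.
  by have := ext_bracket_linear_l z (-1) 0 0; rewrite /= !scaleN1r !addNr.
elim/tens_ind: u => [|b x u IH]; first by rewrite !P0 /= scaler0 addr0.
rewrite !ext_bracket_linear_l IH /=.
have -> : ext_bracket (pure x 1) (a *: v + w)
    = a *: ext_bracket (pure x 1) v + ext_bracket (pure x 1) w.
  apply: tens_eq => k; rewrite tcoefD tcoefZ !ext_bracket_pure_l.
  rewrite tcoefD tcoefZ (bilDr br_bil) -[br x (\sum_(i < _) _)]/(brr x _).
  rewrite linear_sum; congr (_ + _).
  by apply: eq_bigr => i _; rewrite linearZ ext_bracket_pure_l.
rewrite !scalerDr !scalerA mulrC.
by rewrite !addrA [LHS](ACl (1*3*2*4)).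
Qed.

(** Cross terms cancel in pairs by symmetry, and a middle term is a square
    [br x x]. *)
Lemma ext_bracket_alt :
    (forall x : g, x + x = 0) -> (forall x, br x x = 0) ->
  forall u, ext_bracket u u = 0.
Proof.
move=> g2 bxx u; apply: tens_eq => k; rewrite tcoef_ext_bracket.
rewrite (@sum_sym_char2 _ (fun i => br (tcoef u i) (tcoef u (k - i)%N))) //=.
- by case: ifPn => // ko; rewrite -{2}(even_halfK ko) -addnn addnK bxx.
- by move=> i ik; rewrite subKn // (alt_sym g2 (conj br_bil bxx)).
Qed.

Lemma ext_bracket_jacobi :
    (forall x y z, br x (br y z) + br y (br z x) + br z (br x y) = 0) ->
  forall u v w, ext_bracket u (ext_bracket v w)
    + ext_bracket v (ext_bracket w u) + ext_bracket w (ext_bracket u v) = 0.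
Proof.
pose e := ext_bracket; have e_bil : bilinear_for *:%R *:%R e.
  exact: ext_bracket_bilinear.
have eDl := bilDl e_bil; have eDr := bilDr e_bil.
have eZl := bilZl e_bil; have eZr := bilZr e_bil.
have e0l := bil0l e_bil; have e0r := bil0r e_bil.
have three (a : fps K) (p q r p' q' r' : tens g) : p + q + r = 0 ->
    p' + q' + r' = 0 ->
    a *: p + p' + (a *: q + q') + (a *: r + r') = 0.
  move=> pqr pqr'; rewrite !addrA [LHS](ACl (1*3*5*(2*4*6))) /=.
  by rewrite -!scalerDr pqr pqr' scaler0 addr0.
move=> jac u v w; rewrite -/e.
elim/tens_ind: u => [|a x u IH]; first by rewrite !(e0l, e0r) !addr0.
rewrite !(eDl, eDr, eZl, eZr); apply: (@three) => // {u IH}.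
elim/tens_ind: v => [|b y v IH]; first by rewrite !(e0l, e0r) !addr0.
rewrite !(eDl, eDr, eZl, eZr); apply: (@three) => // {v IH}.
elim/tens_ind: w => [|c z w IH]; first by rewrite !(e0l, e0r) !addr0.
rewrite !(eDl, eDr, eZl, eZr); apply: (@three) => // {w IH}.
rewrite /e !ext_bracket_pure; apply: tens_eq => k.
by rewrite !tcoefD !tcoef_pure; case: eqP; rewrite ?addr0.
Qed.

Lemma ext_derivation (T : {linear tens g -> tens g}) :
    (forall x y, T (pure (br x y) 1)
       = ext_bracket (T (pure x 1)) (pure y 1)
         + ext_bracket (pure x 1) (T (pure y 1))) ->
  derivation ext_bracket T.
Proof.
move=> Tp; split; first exact: linearP.
pose e := ext_bracket; have e_bil : bilinear_for *:%R *:%R e.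
  exact: ext_bracket_bilinear.
have eDl := bilDl e_bil; have eDr := bilDr e_bil.
have eZl := bilZl e_bil; have eZr := bilZr e_bil.
have e0l := bil0l e_bil; have e0r := bil0r e_bil.
move=> u v; rewrite -/e.
elim/tens_ind: u => [|a x u IH]; first by rewrite !(e0l, linear0) addr0.
rewrite !eDl linearP /= !eDl !eZl linearD linearZ /= IH addrACA.
rewrite -scalerDr; congr (_ *: _ + _) => {u IH}.
elim/tens_ind: v => [|b y v IH]; first by rewrite !(e0r, linear0) addr0.
rewrite !eDr linearP /= !eDr !eZr linearD linearZ /= IH addrACA.
rewrite -scalerDr; congr (_ *: _ + _).
by rewrite /e ext_bracket_pure Tp.
Qed.

Lemma cext_derivation (f : {linear g -> g}) :
  derivation br f -> derivation ext_bracket (cext f).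
Proof.
move=> [_ fder]; apply: ext_derivation => x y; apply: tens_eq => k.
rewrite tcoefD ext_bracket_pure_l ext_bracket_pure_r !tcoef_cext !tcoef_pure.
by case: eqP; rewrite ?fder // !linear0 (bil0l br_bil) (bil0r br_bil) addr0.
Qed.

End Bracket.

(** * Power series in a locally finite operator *)

Section SeriesOperator.
Variables (K : fieldType) (g : lmodType K) (D : {linear g -> g}).

Lemma iter_linear k : linear (iter k D).
Proof. by elim: k => [|k IH] a x y //=; rewrite IH linearP. Qed.

HB.instance Definition _ k :=
  GRing.isLinear.Build K g g _ (iter k D) (iter_linear k).

Hypothesis D_fin : forall x, is_tensor (fun k => iter k D x).

Lemma series_fin (a : fps K) x :
  is_tensor (fun k => (fcoef a k \*: iter k D) x).
Proof.
have [s Ds] := D_fin x.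
exists [seq (Fps (fun k => fcoef a k * fcoef p.1 k), p.2) | p <- s] => k.
rewrite big_map /= Ds scaler_sumr.
by apply: eq_bigr => p _; rewrite scalerA.
Qed.

(** The operator [a(s D)] for a power series [a]. *)
Definition series_op a : {linear tens g -> tens g} := ext (series_fin a).

Lemma tcoef_series_op a u k : tcoef (series_op a u) k
  = \sum_(i < k.+1) fcoef a (k - i)%N *: iter (k - i) D (tcoef u i).
Proof. by []. Qed.

Lemma series_op_pure a x k :
  tcoef (series_op a (pure x 1)) k = fcoef a k *: iter k D x.
Proof. by rewrite [series_op a _]ext_pure. Qed.

Lemma eq_linear_pure (f f' : {linear tens g -> tens g}) :
  (forall x, f (pure x 1) = f' (pure x 1)) -> f =1 f'.
Proof.
move=> ff u; elim/tens_ind: u => [|a x u IH]; first by rewrite !linear0.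
by rewrite !linearP ff IH.
Qed.

Lemma series_opM a b u : series_op (a * b) u = series_op a (series_op b u).
Proof.
apply: (eq_linear_pure (f := series_op _) (f' := series_op a \o series_op b)).
move=> x; apply: tens_eq => k; rewrite series_op_pure [RHS]tcoef_series_op.
rewrite mulrC fcoefM scaler_suml; apply: eq_bigr => -[i ik] _.
by rewrite series_op_pure linearZ scalerA mulrC /= -iterD subnK.
Qed.

Lemma series_opD a b u : series_op (a + b) u = series_op a u + series_op b u.
Proof.
apply: tens_eq => k; rewrite tcoefD !tcoef_series_op -big_split.
by apply: eq_bigr => i _; rewrite scalerDl.
Qed.

Lemma series_op1 u : series_op 1 u = u.
Proof.
apply: (eq_linear_pure (f' := idfun)) => x; apply: tens_eq => k.
rewrite series_op_pure fcoef1 tcoef_pure.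
by case: k => [|k]; rewrite ?scale1r ?scale0r.
Qed.

Lemma series_opX u : series_op (fpsX K) u = fpsX K *: cext D u.
Proof.
apply: (eq_linear_pure (f' := fpsX K \*: cext D)) => x; apply: tens_eq => k.
rewrite series_op_pure -[RHS]/(tcoef (fpsX K *: cext D _) k) tcoefXZ.
case: k => [|k]; rewrite ?scale0r // tcoef_cext tcoef_pure.
by case: k => [|k]; rewrite ?linear0 ?scale1r ?scale0r.
Qed.

Lemma series_op_derivation (br : g -> g -> g)
    (br_bil : bilinear_for *:%R *:%R br) (a : fps K) :
    (forall k, fcoef a k != 0 -> derivation br (iter k D)) ->
  derivation (ext_bracket br_bil) (series_op a).
Proof.
move=> ader; apply: ext_derivation => x y; apply: tens_eq => k.
rewrite tcoefD ext_bracket_pure_l ext_bracket_pure_r !series_op_pure.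
have [-> | /ader[_ ->]] := eqVneq (fcoef a k) 0.
  by rewrite !scale0r (bil0l br_bil) (bil0r br_bil) addr0.
by rewrite scalerDr (bilZl br_bil) (bilZr br_bil).
Qed.

Lemma series_op_cext a u : cext D (series_op a u) = series_op a (cext D u).
Proof.
apply: tens_eq => k; rewrite tcoef_cext !tcoef_series_op linear_sum.
by apply: eq_bigr => i _; rewrite linearZ tcoef_cext -iterS iterSr.
Qed.

End SeriesOperator.

(** * The substitution of s^2 for t *)

Section SquareVariable.
Variables (K : fieldType) (g : lmodType K).
Implicit Types (u v : tens g) (a : fps K).

Lemma tcoef_sq u k : tcoef (tens_sq u) k = if odd k then 0 else tcoef u k./2.
Proof. by []. Qed.

Lemma tens_sq_inj : injective (@tens_sq K g).
Proof.
move=> u v uv; apply: tens_eq => k.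
have := congr1 (fun w => tcoef w k.*2) uv.
by rewrite !tcoef_sq odd_double doubleK.
Qed.

Lemma tens_sq0 : tens_sq 0 = 0 :> tens g.
Proof. by apply: tens_eq => k; rewrite tcoef_sq; case: ifP. Qed.

Lemma tens_sqD u v : tens_sq (u + v) = tens_sq u + tens_sq v.
Proof.
apply: tens_eq => k; rewrite tcoefD !tcoef_sq tcoefD.
by case: ifP; rewrite ?addr0.
Qed.

Lemma tens_sqZ a u : tens_sq (a *: u) = fps_sq a *: tens_sq u.
Proof.
apply: tens_eq => k; rewrite tcoef_sq !tcoefZ.
rewrite -(sum_even_antidiag (fun i j => fcoef a i *: tcoef u j)).
apply: eq_bigr => i _; rewrite tcoef_sq /=.
by case: (odd i); case: (odd (k - i)); rewrite ?scale0r ?scaler0.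
Qed.

Lemma tens_sq_cext (f : {linear g -> g}) u :
  tens_sq (cext f u) = cext f (tens_sq u).
Proof.
apply: tens_eq => k; rewrite tcoef_cext !tcoef_sq tcoef_cext.
by case: ifP; rewrite ?linear0.
Qed.

Lemma tens_sq_bracket (br : g -> g -> g)
    (br_bil : bilinear_for *:%R *:%R br) u v :
  tens_sq (ext_bracket br_bil u v) = ext_bracket br_bil (tens_sq u) (tens_sq v).
Proof.
apply: tens_eq => k; rewrite tcoef_sq !tcoef_ext_bracket.
rewrite -(sum_even_antidiag (fun i j => br (tcoef u i) (tcoef v j))).
apply: eq_bigr => i _; rewrite !tcoef_sq.
by case: (odd i); case: (odd (k - i)); rewrite ?(bil0l br_bil) ?(bil0r br_bil).
Qed.

Lemma iter_comp_self (D : g -> g) k x : iter k (D \o D) x = iter k.*2 D x.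
Proof. by elim: k => //= k ->. Qed.

Lemma comp_self_fin (D : g -> g) :
    (forall x, is_tensor (fun k => iter k D x)) ->
  forall x, is_tensor (fun k => iter k (D \o D) x).
Proof.
move=> D_fin x; have [s Ds] := D_fin x.
exists [seq (Fps (fun k => fcoef p.1 k.*2), p.2) | p <- s] => k.
by rewrite big_map iter_comp_self Ds.
Qed.

(** [a(t D^2)] becomes [a(s^2 D^2)], the value of [fps_sq a] at [s D]. *)
Lemma tens_sq_series (D : {linear g -> g})
    (D_fin : forall x, is_tensor (fun k => iter k D x))
    (D2_fin : forall x, is_tensor (fun k => iter k (D \o D) x)) a u :
  tens_sq (series_op D2_fin a u) = series_op D_fin (fps_sq a) (tens_sq u).
Proof.
apply: tens_eq => k; rewrite tcoef_sq !tcoef_series_op.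
rewrite -(sum_even_antidiag
  (fun i j => fcoef a j *: iter j (D \o D) (tcoef u i))).
apply: eq_bigr => i _; rewrite tcoef_sq /=.
case: (odd i); first by rewrite linear0 scaler0.
case ki: (odd (k - i)); first by rewrite scale0r.
by rewrite iter_comp_self even_halfK ?ki.
Qed.

End SquareVariable.

(** * The deformation with linear part [D x, D y] *)

Section Deform.
Variables (K : fieldType) (g : lmodType K) (br : g -> g -> g).
Variable D : {linear g -> g}.
Hypotheses (char2 : 2%N \in [pchar K]) (br_lie : lie_bracket br).
Hypothesis derD : derivation br D.
Hypothesis D_fin : forall x, is_tensor (fun k => iter k D x).

Let g2 (x : g) : x + x = 0.
Proof. by rewrite -[x]scale1r -scalerDl addrr_pchar2 // scale0r. Qed.

Let tens2 (u : tens g) : u + u = 0.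
Proof. by apply: tens_eq => k; rewrite tcoefD g2. Qed.

Let br_bil := br_lie.1.1.
Let D2_fin := comp_self_fin D_fin.
Let F := additive_series K.
Let G := additive_inverse K.
Let b0 := ext_bracket br_bil.
Let U := series_op D_fin (F * F).
Let P := series_op D_fin (G * G).
Let phi := series_op D_fin (1 + F).

(* The twisted bracket over K[[s]], and over K[[t]] below.  As [F] and [G] have
   coefficients 0 and 1, their squares are [F(x^2)] and [G(x^2)], so that [U] and
   [P] are the series [F] and [G] in [s^2 D^2]. *)
Let bs := twist b0 (cext D) U P (fpsX K * fpsX K).
Let bt :=
  twist b0 (cext D) (series_op D2_fin F) (series_op D2_fin G) (fpsX K).

(** The square of a derivation is one in characteristic 2: the cross terms
    [2 [d x, d y]] vanish. *)
Lemma iter_pow2_derivation k : 2%N.-nat k -> derivation br (iter k D).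
Proof.
move=> /p_natP[m ->]; split; first exact: iter_linear.
elim: m => [|m IH] x y; first by rewrite derD.2.
rewrite expnS mul2n -addnn !iterD !IH linearD /= !IH.
by rewrite addrA [LHS](ACl (1*4*(2*3))) /= g2 addr0.
Qed.

Let b0_bil : bilinear_for *:%R *:%R b0.
Proof. exact: ext_bracket_bilinear. Qed.

Let b0_alt u : b0 u u = 0.
Proof. exact: (ext_bracket_alt br_bil g2 br_lie.1.2). Qed.

Let derU : derivation b0 U.
Proof.
apply: series_op_derivation => k; rewrite additive_series_sqr //= => Fk.
apply: iter_pow2_derivation; move: Fk.
case: ifPn => [|ke]; first by rewrite eqxx.
by rewrite -pow2_even //; case: (2%N.-nat k); rewrite ?eqxx.
Qed.

Let sqF : F * F = F + fpsX K.
Proof. by rewrite {3}/F additive_seriesE // addrAC fps_addcc // add0r. Qed.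

Let UU u : U (U u) = U u + (fpsX K * fpsX K) *: cext D (cext D u).
Proof.
rewrite /U -series_opM.
have -> : F * F * (F * F) = F * F + fpsX K * fpsX K.
  rewrite {1 2}sqF mulrDl !mulrDr (mulrC (fpsX K) F) addrA -(addrA (F * F)).
  by rewrite fps_addcc // addr0.
by rewrite series_opD (series_opM _ (fpsX K)) !series_opX linearZ /= scalerA.
Qed.

Let sqFG : (1 + F * F) * (G * G) = 1.
Proof.
have -> : 1 + F * F = (1 + F) * (1 + F).
  by rewrite mulrDl !mulrDr !mulr1 mul1r addrA -(addrA 1) fps_addcc // addr0.
by rewrite mulrACA additive_inverseP // mulr1.
Qed.

Let PK u : P (u + U u) = u.
Proof.
rewrite -{1}(series_op1 D_fin u) -series_opD /P -series_opM mulrC sqFG.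
exact: series_op1.
Qed.

Let KP u : P u + U (P u) = u.
Proof.
rewrite -{1}(series_op1 D_fin (P u)) -series_opD -series_opM sqFG.
exact: series_op1.
Qed.

Let phiE u : phi u = u + U u + fpsX K *: cext D u.
Proof.
rewrite /phi {1}/F additive_seriesE // addrCA addrC.
by rewrite !series_opD series_op1 series_opX.
Qed.

Let phi_bracket u v : phi (bs u v) = b0 (phi u) (phi v).
Proof.
rewrite !phiE; apply: (twist_conjugate tens2 b0_bil) => //.
- exact: cext_derivation.
- by move=> w; apply: series_op_cext.
Qed.

Let phiK : cancel phi (series_op D_fin G).
Proof.
by move=> u; rewrite /phi -series_opM mulrC additive_inverseP // series_op1.
Qed.

Let phiVK : cancel (series_op D_fin G) phi.
Proof.
by move=> u; rewrite /phi -series_opM additive_inverseP // series_op1.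
Qed.

Let sqrX : fps_sq (fpsX K) = fpsX K * fpsX K.
Proof. by rewrite fps_sqr // => k; apply: natr_bool_idem. Qed.

Let bs_sq u v : bs (tens_sq u) (tens_sq v) = tens_sq (bt u v).
Proof.
rewrite /bs /bt /twist /U /P additive_series_sqr // additive_inverse_sqr //.
rewrite tens_sqD tens_sq_series tens_sqD tens_sqZ !tens_sq_bracket sqrX.
by rewrite !tens_sq_series !tens_sq_cext.
Qed.

(** Jacobi holds for [bs] since [phi] is injective and carries [bs] to [b0], and
    then for [bt] since [tens_sq] is injective. *)
Let bt_lie : lie_bracket bt.
Proof.
split; first split; first exact: twist_bilinear.
  exact: twist_alt b0_alt.
move=> u v w; apply: tens_sq_inj; rewrite tens_sq0 2!tens_sqD -!bs_sq.
apply: (can_inj phiK); rewrite 2!linearD linear0 !phi_bracket.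
exact: (ext_bracket_jacobi br_bil br_lie.2).
Qed.

Let cext_pure x : cext D (pure x 1) = pure (D x) 1.
Proof.
apply: tens_eq => k; rewrite tcoef_cext !tcoef_pure.
by case: eqP; rewrite ?linear0.
Qed.

Let bt_pure x y : bt (pure x 1) (pure y 1) =
  pure (br x y) 1 + series_op D2_fin G
     (b0 (series_op D2_fin F (pure x 1)) (series_op D2_fin F (pure y 1))
      + fpsX K *: pure (br (D x) (D y)) 1).
Proof. by rewrite /bt /twist !cext_pure /b0 !ext_bracket_pure. Qed.

(** The series [F] has no constant term, so that the bracket of two of its values
    is [O(t^2)]. *)
Let bt_pure_low x y k : (k <= 1)%N -> tcoef (bt (pure x 1) (pure y 1)) k =
  if k == 0%N then br x y else br (D x) (D y).
Proof.
have F0 z : tcoef (series_op D2_fin F (pure z 1)) 0 = 0.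
  by rewrite series_op_pure /= scale0r.
rewrite bt_pure; set V := _ + _ *: _.
have V0 : tcoef V 0 = 0.
  by rewrite /V tcoefD tcoefXZ addr0 tcoef_ext_bracket big_ord1 F0
    (bil0l br_bil).
have V1 : tcoef V 1 = br (D x) (D y).
  rewrite /V tcoefD tcoefXZ tcoef_pure tcoef_ext_bracket 2!big_ord_recl.
  by rewrite big_ord0 !F0 (bil0l br_bil) (bil0r br_bil) !add0r.
case: k => [|[|//]] _; rewrite tcoefD tcoef_pure tcoef_series_op.
  by rewrite big_ord1 V0 linear0 ?scaler0 addr0.
by rewrite 2!big_ord_recl big_ord0 V0 V1 linear0 ?scaler0 !add0r addr0 scale1r.
Qed.

Lemma bt_deformation :
  deformation br (fun k x y => tcoef (bt (pure x 1) (pure y 1)) k) bt.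
Proof.
have bt_bil := bt_lie.1.1.
split=> // [k|x y].
  split=> [|x]; last by rewrite bt_lie.1.2.
  split=> [y c x z|x c y z].
    by rewrite pure_linear (bilDl bt_bil) (bilZl bt_bil) tcoefD tcoefCZ.
  by rewrite pure_linear (bilDr bt_bil) (bilZr bt_bil) tcoefD tcoefCZ.
exact: bt_pure_low.
Qed.

Lemma bt_linear_part x y :
  tcoef (bt (pure x 1) (pure y 1)) 1 = br (D x) (D y).
Proof. exact: bt_pure_low. Qed.

Lemma bt_sqrt_isomorphic : sqrt_isomorphic br bt.
Proof.
exists b0, bs, (fun k => fcoef (1 + F) k \*: iter k D), phi; split.
- by split; [exact: b0_bil | exact: ext_bracket_pure].
- by split; [exact: twist_bilinear | exact: bs_sq].
- by exists (series_op D_fin G); [exact: phiK | exact: phiVK].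
- split=> [x|x k]; last by rewrite series_op_pure.
  by rewrite /= addr0 scale1r.
- exact: phi_bracket.
Qed.

(** Expanding by the Leibniz rule leaves the three Jacobi identities for
    [(x, D y, D z)], [(y, D x, D z)] and [(z, D x, D y)]. *)
Lemma derivation_square_cocycle : cocycle2 br (fun x y => br (D x) (D y)).
Proof.
have [[_ bxx] jac] := br_lie.
have brC := alt_sym g2 (conj br_bil bxx).
have gN (x : g) : - x = x by apply/esym/eqP; rewrite -addr_eq0 g2.
split.
  split=> [|x]; last exact: bxx.
  split=> [z a x y|z a x y] /=; rewrite linearP /=.
    by rewrite (bilDl br_bil) (bilZl br_bil).
  by rewrite (bilDr br_bil) (bilZr br_bil).
have jac' x y z : br x (br y z) = br y (br x z) + br z (br x y).
  apply/(char2_add_eq0 g2); rewrite -(jac x y z) addrA; congr (_ + br _ _ + _).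
  exact: brC.
move=> x y z; rewrite /CE2 !gN !derD.2 !(bilDl br_bil).
rewrite (jac' x (D y) (D z)) (jac' y (D x)) (jac' z (D x) (D y)).
rewrite !(brC (br _ _) (D _)) (brC (D x) y) (brC (D x) z) (brC (D y) z) !addrA.
(* Every term now occurs exactly twice. *)
rewrite [LHS](ACl ((1*10)*(2*8)*(3*12)*(4*7)*(5*11)*(6*9))) /=.
by rewrite !g2.
Qed.

Lemma semitrivial_of_orbit_fin :
  trivial_cocycle br (fun x y => br (D x) (D y))
  \/ semitrivial_cocycle br (fun x y => br (D x) (D y)).
Proof.
have cD := derivation_square_cocycle.
have [triv | ntriv] := pselect (coboundary2 br (fun x y => br (D x) (D y))).
  by left.
right; split=> //; exists (fun k x y => tcoef (bt (pure x 1) (pure y 1)) k), bt.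
split; first exact: bt_deformation.
  exact: bt_linear_part.
exact: bt_sqrt_isomorphic.
Qed.

End Deform.

(** * Locally finite derivations *)

Section OrbitFinite.
Variables (K : fieldType) (g : lmodType K) (D : {linear g -> g}).

Lemma nilpotent_orbit_fin n :
  (forall x, iter n D x = 0) -> forall x, is_tensor (fun k => iter k D x).
Proof.
move=> Dn x.
exists [seq (Fps (fun k => (k == j)%:R), iter j D x) | j <- iota 0 n] => k.
rewrite big_map /=; have [kn | nk] := ltnP k n.
  rewrite (bigD1_seq k) ?mem_iota ?iota_uniq //= eqxx scale1r.
  by rewrite big1 ?addr0 // => j; rewrite eq_sym => /negbTE->; rewrite scale0r.
rewrite big1_seq => [|j /andP[_]].
  by rewrite -(subnK nk) iterD Dn; elim: (k - n)%N => //= m ->; rewrite linear0.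
rewrite mem_iota => /andP[_ jn]; rewrite gtn_eqF ?scale0r //.
exact: leq_trans nk.
Qed.

Lemma quadratic_orbit_fin (alpha : K) :
    (forall x, D (D x) = alpha *: D x) ->
  forall x, is_tensor (fun k => iter k D x).
Proof.
move=> DD x.
pose a := Fps (fun k => if k is j.+1 then alpha ^+ j else 0).
exists [:: (1, x); (a, D x)] => k.
rewrite big_cons big_seq1 /=; case: k => [|k].
  by rewrite scale1r scale0r addr0.
rewrite scale0r add0r; elim: k => [|k IH]; first by rewrite scale1r.
by rewrite iterS IH linearZ /= DD scalerA exprSr.
Qed.
End OrbitFinite.

Theorem theorem2p3p2 (K : fieldType) (char2 : 2%N \in [pchar K])
    (perfK : perfect_field K) (g : lmodType K) (br : g -> g -> g)
    (br_lie : lie_bracket br) (D : g -> g) (derD : derivation br D)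
    (hD : (exists alpha : K, forall x : g, D (D x) = alpha *: D x)
          \/ (exists n : nat, forall x : g, iter n D x = 0)) :
  trivial_cocycle br (fun x y : g => br (D x) (D y))
  \/ semitrivial_cocycle br (fun x y : g => br (D x) (D y)).
Proof.
pose Dl := lin_pack derD.1.
have D_fin x : is_tensor (fun k => iter k Dl x).
  case: hD => [[alpha DD] | [n Dn]].
    exact: (quadratic_orbit_fin (D := Dl) DD).
  exact: (nilpotent_orbit_fin (D := Dl) Dn).
exact: (semitrivial_of_orbit_fin (D := Dl) char2 br_lie derD D_fin).
Qed.
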